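(* Let $\alpha\in(0,1]$, let $X$ and $Y$ be two discrete real-valued random variables, let $\lambda=\mathrm{VaR}_\alpha(X)\in\mathbb R$, let $\mathcal Y$ be the support of $Y$, and let $\lambda_-(\mathcal Y)$ be the left predecessor of $\lambda$ in $\mathcal Y$ (assumed well defined). Then $$\mathbb P(Y\le\lambda_-(\mathcal Y))\ge\alpha \iff \mathrm{VaR}_\alpha(Y)<\mathrm{VaR}_\alpha(X),$$ $$\mathbb P(Y\le\lambda_-(\mathcal Y))<\alpha \iff \mathrm{VaR}_\alpha(Y)\ge\mathrm{VaR}_\alpha(X).$$
   Context: For a real-valued random variable $X$ and $\alpha\in(0,1]$, $\mathrm{VaR}_\alpha(X):=\inf\{\lambda\in\mathbb R:\mathbb P(X\le\lambda)\ge\alpha\}$. The support $\mathcal Y$ of a discrete random variable $Y$ is the set of values that $Y$ takes. For $\lambda\in\mathbb R$, the left predecessor of $\lambda$ in $\mathcal Y$ is $$\lambda_-(\mathcal Y):=\begin{cases}\max\{y\in\mathcal Y: y<\lambda\}, & \text{if }\lambda>\min\mathcal Y,\\ \lambda-1, & \text{if }\lambda\le\min\mathcal Y.\end{cases}$$ It is well defined when the minimum and the maximum appearing here exist (e.g. whenever $\mathcal Y$ is finite). *)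

(* Defs.v *)
From mathcomp Require Import all_boot all_order all_algebra.
From mathcomp Require Import all_classical all_reals all_analysis.

Set Implicit Arguments.
Unset Strict Implicit.
Unset Printing Implicit Defensive.

Import Order.TTheory GRing.Theory Num.Theory.

Local Open Scope classical_set_scope.
Local Open Scope ring_scope.

(* The infimum is taken in \bar R, so VaR is +oo when no real level
   qualifies; for 0 < a <= 1 this requires a = 1 and X unbounded above. *)
Definition VaR d (T : measurableType d) (R : realType)
    (P : probability T R) (X : {RV P >-> R}) (a : R) : \bar R :=
  ereal_inf [set l%:E | l in [set l : R | (a%:E <= P [set t | (X t <= l)%R])%E]].

Arguments VaR {d T R} P X a.

Section LeftPredecessor.
Context {R : realType}.
Implicit Types (A : set R) (l : R).

Definition minima A : set R := A `&` lbound A.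
Definition maxima A : set R := A `&` ubound A.

(* Junk value 0 when the minimum (resp. maximum) does not exist. *)
Definition set_min A : R := xget 0 (minima A).
Definition set_max A : R := xget 0 (maxima A).

Definition left_pred A l : R :=
  if set_min A < l then set_max [set y | A y /\ y < l] else l - 1.

Definition left_pred_well_defined A l : Prop :=
  minima A !=set0 /\
  (set_min A < l -> maxima [set y | A y /\ y < l] !=set0).

End LeftPredecessor.

(* Main.v *)
Require Import Defs.
From mathcomp Require Import all_boot all_order all_algebra.
From mathcomp Require Import all_classical all_reals all_analysis.

Import Order.TTheory GRing.Theory Num.Theory.

Local Open Scope classical_set_scope.
Local Open Scope ring_scope.

(** No value of [Y] lies strictly between the left predecessor [q] of [lambda]
    and [lambda], so [Y <= l] implies [Y <= q] for every [l < lambda]: some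
    level below [lambda] reaches [alpha] iff [q] does. *)

(** The maximum is attained, hence is itself one of the points below [l]; a mere supremum could
    equal [l]. *)
Lemma left_pred_lt (R : realType) (A : set R) (l : R) :
  left_pred_well_defined A l -> left_pred A l < l.
Proof.
rewrite /left_pred => -[_ hmax]; case: ifPn => [/hmax [m Am]|_].
  by have [[]] := xgetPex 0 (ex_intro _ m Am).
by rewrite gtrBl.
Qed.

Lemma left_pred_ge (R : realType) (A : set R) (l y : R) :
  left_pred_well_defined A l -> A y -> y < l -> y <= left_pred A l.
Proof.
rewrite /left_pred => -[[m Am] hmax] Ay yl; case: ifPn => [/hmax [M AM]|].
  by have [_] := xgetPex 0 (ex_intro _ M AM); apply.
(* The default [l - 1] cannot occur here: [set_min A <= y < l] contradicts the branch condition. *)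
have [_ minA] := xgetPex 0 (ex_intro _ m Am).
by rewrite (le_lt_trans (minA _ Ay) yl).
Qed.

Lemma measurable_mfun_le {d : measure_display} {T : measurableType d}
    {R : realType} (X : {mfun T >-> R}) (l : R) :
  measurable [set t | X t <= l].
Proof.
have -> : [set t | X t <= l] = X @^-1` `]-oo, l].
  by apply/seteqP; split=> t /=; rewrite in_itv.
exact: measurable_funPTI.
Qed.

Lemma VaR_lt_left_pred {d : measure_display} {T : measurableType d}
    {R : realType} (P : probability T R) (Y : {RV P >-> R}) (alpha lambda : R) :
  left_pred_well_defined (range Y) lambda ->
  (alpha%:E <= P [set t | (Y t <= left_pred (range Y) lambda)%R])%E <->
  (VaR P Y alpha < lambda%:E)%E.
Proof.
move=> hpred; split=> [hq|/ereal_inf_lt [_ [l hl <-]]].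
  (* The left predecessor is itself an admissible level, so it bounds the infimum from above. *)
  apply: (@le_lt_trans _ _ (left_pred (range Y) lambda)%:E).
    by apply: ereal_inf_lbound; exists (left_pred (range Y) lambda).
  by rewrite lte_fin left_pred_lt.
rewrite lte_fin => ltl; apply: (le_trans hl).
apply: le_measure; rewrite ?inE; [exact: measurable_mfun_le..|].
(* The support is the full [range Y], so the inclusion of events holds at every [t], not just almost
   surely. *)
move=> t /= Ytl; apply: left_pred_ge => //.
exact: le_lt_trans ltl.
Qed.

Theorem lemma2 (d : measure_display) (T : measurableType d) (R : realType)
    (P : probability T R) (alpha : R) (halpha : 0 < alpha <= 1)
    (X Y : {dRV P >-> R}) (lambda : R) (hlambda : VaR P X alpha = lambda%:E)
    (hpred : left_pred_well_defined (range Y) lambda) :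
  ((alpha%:E <= P [set t | (Y t <= left_pred (range Y) lambda)%R])%E <->
     (VaR P Y alpha < VaR P X alpha)%E) /\
  ((P [set t | (Y t <= left_pred (range Y) lambda)%R] < alpha%:E)%E <->
     (VaR P X alpha <= VaR P Y alpha)%E).
Proof.
rewrite hlambda; have hiff := VaR_lt_left_pred P Y alpha lambda hpred.
(* The order on [\bar R] is total, so the second equivalence negates both sides of the first. *)
split=> //; rewrite ltNge (leNgt lambda%:E).
by split=> /negP h; apply/negP => /hiff.
Qed.
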